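(* Let $k,r$ be rational numbers with $r\neq0$, let $\varepsilon\in\{1,-1\}$, put $t=rk^8$ and $$m=\frac{k}{r}(t-3\varepsilon).$$ Then the following two tuples $(s_0,\dots,s_8)$ are mutually conjugate solutions of $|F(9,m)|=1$: (1) $s_0=1,\ s_1=-\varepsilon rk^7,\ s_2=\varepsilon rk^6,\ s_3=-\varepsilon rk^5,\ s_4=2\varepsilon rk^4,\ s_5=-2\varepsilon rk^3,\ s_6=\varepsilon rk^2,\ s_7=-\varepsilon rk,\ s_8=\varepsilon r$; (2) $$\begin{aligned} s_0&=9t^4-54\varepsilon t^3+97t^2-48\varepsilon t+1,\\ s_1&=rk^7(9t^3-51\varepsilon t^2+84t-35\varepsilon),\\ s_2&=rk^6(9t^3-48\varepsilon t^2+72t-25\varepsilon),\\ s_3&=rk^5(9t^3-45\varepsilon t^2+61t-17\varepsilon),\\ s_4&=rk^4(9t^3-42\varepsilon t^2+51t-11\varepsilon),\\ s_5&=rk^3(9t^3-39\varepsilon t^2+42t-7\varepsilon),\\ s_6&=rk^2(9t^3-36\varepsilon t^2+34t-4\varepsilon),\\ s_7&=rk(9t^3-33\varepsilon t^2+27t-2\varepsilon),\\ s_8&=r(9t^3-30\varepsilon t^2+21t-\varepsilon). \end{aligned}$$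
   Context: For $N\ge1$ and a tuple $s=(s_0,\dots,s_{N-1})$ let $X(s)$ be the $N\times N$ matrix with (indices $0\le i,j\le N-1$) entry $s_{i-j}$ if $i\ge j$ and $m\,s_{N+i-j}$ if $i<j$; it is the matrix of the form $s_0+s_1\sqrt[N]{m}+\dots+s_{N-1}\sqrt[N]{m^{N-1}}$. The norm is $|F(N,m)|=\det X(s)$. Tuples $s,\overline{s}$ are conjugate if $X(s)X(\overline{s})=|F(N,m)|\cdot E$, with $E$ the identity matrix. Here $N=9$. *)

(* Defs.v *)
From mathcomp Require Import all_boot all_order all_algebra.
Set Implicit Arguments.
Unset Strict Implicit.
Unset Printing Implicit Defensive.
Import GRing.Theory.
Local Open Scope ring_scope.

(* The matrix of the form s_0 + s_1 m^(1/N) + ... + s_(N-1) m^((N-1)/N).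
   Subtraction on indices is truncated, but neither branch is affected:
   j <= i in the first, and i < j < N in the second. *)
Definition form_mx (F : comNzRingType) (N : nat) (m : F) (s : N.-tuple F)
    : 'M[F]_N :=
  \matrix_(i < N, j < N)
    if (j <= i)%N then s`_(i - j) else m * s`_(N + i - j).

(* The norm, written |F(N,m)|: despite the bars it is the determinant itself,
   with no absolute value taken. *)
Definition form_norm (F : comNzRingType) (N : nat) (m : F) (s : N.-tuple F)
    : F :=
  \det (form_mx m s).

Definition form_conjugate (F : comNzRingType) (N : nat) (m : F)
    (s s' : N.-tuple F) : Prop :=
  form_mx m s *m form_mx m s' = (form_norm m s)%:M.

(* Main.v *)
Require Import Defs.
From mathcomp Require Import all_boot all_order all_algebra.
From mathcomp Require Import algC cyclotomic ring zify.
Import GRing.Theory.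
Local Open Scope ring_scope.

(** The matrix of a form is the matrix of multiplication by
    s_0 + s_1 x + ... + s_(N-1) x^(N-1) on F[x]/(x^N - m), i.e. the value of
    that polynomial at the matrix C of multiplication by x ([form_mx_horner]).
    Such matrices commute, and a product of two of them is again of this kind,
    hence is determined by its first column ([form_mx_mul_eq1]).  So it takes
    only nine scalar identities to see that the two tuples have product 1, and
    all that remains is that the first one has norm 1.

    For this, the key is the factorization, modulo x^9 = m,
      (k - x)^3 (k^3 - x^3)^2 = (3 eps k / r) (s_0 + s_1 x + ... + s_8 x^8)
    with s the first tuple; the scalar in front is also k^9 - m.  The norm of
    k - x is k^9 - m ([det_sub_root_mx]), and that of k^3 - x^3 is (k^9 - m)^3
    ([det_sub_root_mx_cube_rat]), because k^3 - x^3 is the product of k - w x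
    over the cube roots of unity w and each of these factors has norm
    k^9 - w^9 m = k^9 - m.  The left-hand side therefore has norm
    (k^9 - m)^(3 + 6), which is exactly the ninth power of the scalar
    ([form_norm_mul_cubes]); when k <> 0 the scalar cancels and leaves 1.
    When k = 0, also m = 0 and the matrix is triangular with diagonal entries
    s_0 = 1 ([form_norm0]). *)

(** * Forms as polynomials in one matrix *)

(** Multiplication by x on F[x]/(x^(n+1) - m), in the basis of powers of x; it
    is the transpose of the companion matrix of x^(n+1) - m. *)
Definition root_mx {F : comNzRingType} {n : nat} (m : F) : 'M[F]_n.+1 :=
  \matrix_(i, j) ((i == j.+1 :> nat)%:R + m *+ ((i == 0%N :> nat) && (j == n :> nat))).

Lemma mul_root_mxE {F : comNzRingType} {n : nat} (m : F) (A : 'M[F]_n.+1) i j :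
  (A * root_mx m) i j =
    if (j < n)%N then A i (inord j.+1) else A i ord0 * m.
Proof.
rewrite mxE; case: ifPn => lt_jn.
  rewrite (bigD1 (inord j.+1)) //= big1 => [|l ne_lj]; rewrite mxE.
    by rewrite inordK // eqxx /= mulr0n !addr0 mulr1.
  have -> : (l == j.+1 :> nat) = false.
    by apply: contraNF ne_lj => /eqP e; apply/eqP/val_inj; rewrite /= inordK.
  by rewrite (ltn_eqF lt_jn) andbF addr0 mulr0.
have jn : j = n :> nat by have := ltn_ord j; lia.
rewrite (bigD1 ord0) //= big1 => [|l ne_l0]; rewrite mxE jn eqxx.
  by rewrite /= mulr1n add0r addr0.
have -> : (l == n.+1 :> nat) = false by rewrite ltn_eqF.
have -> : (l == 0%N :> nat) = false.
  by apply: contraNF ne_l0 => /eqP e; apply/eqP/val_inj.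
by rewrite addr0 mulr0.
Qed.

(** Multiplication by x^p sends x^j to x^(j+p) or, past the top degree, to
    m x^(j+p-n-1): this is the form matrix of the monomial x^p. *)
Lemma expr_root_mxE {F : comNzRingType} {n : nat} (m : F) p (i j : 'I_n.+1) :
  (p <= n)%N ->
  (root_mx m ^+ p) i j =
    if (j <= i)%N then (i - j == p)%N%:R else m * (n.+1 + i - j == p)%N%:R.
Proof.
elim: p i j => [|p IHp] i j le_pn.
  rewrite expr0 mxE subn_eq0 -val_eqE /=; have ltj := ltn_ord j.
  case: leqP => [le_ji|lt_ij]; first by rewrite eqn_leq le_ji andbT.
  have -> : (n.+1 + i - j == 0)%N = false by lia.
  by rewrite (ltn_eqF lt_ij) mulr0.
rewrite exprSr mul_root_mxE; have ltj := ltn_ord j; have lti := ltn_ord i.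
case: ifPn => lt_jn; rewrite IHp ?(ltnW le_pn) ?inordK //=.
  case: ltngtP => [lt_ji|lt_ij|eq_ij].
  - by rewrite (_ : (i - j.+1 == p)%N = (i - j == p.+1)%N); last lia.
  - by rewrite (_ : (n.+1 + i - j.+1 == p)%N = (n.+1 + i - j == p.+1)%N); last lia.
  - rewrite (_ : (n.+1 + i - j.+1 == p)%N = false); last lia.
    by rewrite (_ : (i - j == p.+1)%N = false) ?mulr0 //; lia.
rewrite mulrC; case: leqP => [le_ji|lt_ij].
  rewrite (_ : (i - 0 == p)%N = false); last lia.
  by rewrite (_ : (i - j == p.+1)%N = false) ?mulr0 //; lia.
by rewrite (_ : (i - 0 == p)%N = (n.+1 + i - j == p.+1)%N) //; lia.
Qed.

Lemma form_mx_horner {F : comNzRingType} {n : nat} (m : F) (s : n.+1.-tuple F) :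
  form_mx m s = horner_mx (root_mx m) (\poly_(p < n.+1) s`_p).
Proof.
rewrite poly_def raddf_sum /=; apply/matrixP => i j; rewrite summxE mxE.
have ltj := ltn_ord j; have lti := ltn_ord i.
under eq_bigr => p _.
  rewrite linearZ /= rmorphXn /= horner_mx_X mxE expr_root_mxE ?leq_ord //.
  over.
case: leqP => [le_ji|lt_ij].
  have lt_n : (i - j < n.+1)%N by lia.
  rewrite (bigD1 (Ordinal lt_n)) //= eqxx mulr1 big1 ?addr0 // => p.
  by rewrite -val_eqE /= eq_sym => /negPf->; rewrite mulr0.
have lt_n : (n.+1 + i - j < n.+1)%N by lia.
rewrite (bigD1 (Ordinal lt_n)) //= eqxx mulr1 mulrC big1 ?addr0 // => p.
by rewrite -val_eqE /= eq_sym => /negPf->; rewrite !mulr0.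
Qed.

Lemma root_mx_exp_size {F : comNzRingType} {n : nat} (m : F) :
  root_mx m ^+ n.+1 = m%:M :> 'M_n.+1.
Proof.
apply/matrixP => i j; rewrite exprSr mul_root_mxE mxE -val_eqE /=.
have ltj := ltn_ord j; have lti := ltn_ord i.
case: ifPn => lt_jn; rewrite expr_root_mxE ?inordK //=.
  case: leqP => [le_ij|lt_ji].
    by rewrite (_ : (n.+1 + i - j.+1 == n)%N = (nat_of_ord i == j)%N) ?mulr_natr //; lia.
  rewrite (_ : (i - j.+1 == n)%N = false); last lia.
  by rewrite (_ : (nat_of_ord i == j)%N = false) //; lia.
by rewrite (_ : (i - 0 == n)%N = (nat_of_ord i == j)%N) ?mulr_natl //; lia.
Qed.

Lemma form_mx_mulC {F : comNzRingType} {n : nat} (m : F) (s s' : n.+1.-tuple F) :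
  form_mx m s *m form_mx m s' = form_mx m s' *m form_mx m s.
Proof.
by rewrite !form_mx_horner -![_ *m _]/(_ * _) -!rmorphM /= mulrC.
Qed.

(** A polynomial A in C commutes with C, and C^j sends the first basis vector to
    the j-th one, so that column j of A is C^j applied to its first column. *)
Lemma form_mx_mul_eq1 {F : comNzRingType} {n : nat} (m : F)
    (s s' : n.+1.-tuple F) :
  (forall i, (form_mx m s *m form_mx m s') i ord0 = (i == ord0)%:R) ->
  form_mx m s *m form_mx m s' = 1%:M.
Proof.
rewrite !form_mx_horner -[_ *m _]/(_ * _) -rmorphM /=.
move: (_ * _) => p col0; set A := horner_mx _ p in col0 *.
have A0 : A *m delta_mx ord0 (ord0 : 'I_1) = delta_mx ord0 ord0.
  by rewrite -colE; apply/colP => i; rewrite !mxE col0 andbT.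
have colj j : delta_mx j (ord0 : 'I_1) =
    root_mx m ^+ j *m delta_mx ord0 ord0 :> 'cV_n.+1.
  rewrite -colE; apply/colP => i; rewrite !mxE expr_root_mxE ?leq_ord //=.
  by rewrite subn0 val_eqE andbT.
apply/matrixP => i j; have: col j A = col j 1%:M.
  have AC : A * root_mx m ^+ j = root_mx m ^+ j * A.
    by rewrite -(horner_mx_X (root_mx m)) -rmorphXn /= -!rmorphM /= mulrC.
  by rewrite !colE mul1mx colj mulmxA [A *m _]AC -mulmxA A0.
by move/colP/(_ i); rewrite !mxE.
Qed.

(** Homogeneity of the norm, with s' = c s expressed entrywise. *)
Lemma form_normZ {F : comNzRingType} {n : nat} (m c : F) (s s' : n.+1.-tuple F) :
  (forall i : 'I_n.+1, s'`_i = c * s`_i) ->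
  form_norm m s' = c ^+ n.+1 * form_norm m s.
Proof.
move=> ss'; rewrite /form_norm -detZ; congr (\det _); apply/matrixP => i j.
rewrite !mxE; have ltj := ltn_ord j; have lti := ltn_ord i.
case: leqP => [le_ji|lt_ij].
  have lt_n : (i - j < n.+1)%N by lia.
  by rewrite (ss' (Ordinal lt_n)).
have lt_n : (n.+1 + i - j < n.+1)%N by lia.
by rewrite (ss' (Ordinal lt_n)) mulrCA.
Qed.

(** With m = 0 the form matrix is lower triangular. *)
Lemma form_norm0 {F : comNzRingType} {n : nat} (s : n.+1.-tuple F) :
  form_norm 0 s = s`_0 ^+ n.+1.
Proof.
rewrite /form_norm det_trig => [|]; last first.
  by apply/is_trig_mxP => i j lt_ij; rewrite mxE leqNgt lt_ij mul0r.
under eq_bigr => i _ do rewrite mxE leqnn subnn.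
by rewrite prodr_const card_ord.
Qed.

(** * Norms of the factors *)

(** The norm of a - b x.  The first row has only the entries a, at the left end,
    and - b m, at the right end; their minors are triangular, with a and - b
    respectively on the diagonal.  The size is at least 2 so that these two
    entries are distinct. *)
Lemma det_sub_root_mx {F : comNzRingType} {n : nat} (m a b : F) :
  \det (a%:M - b *: root_mx m : 'M_n.+2) = a ^+ n.+2 - b ^+ n.+2 * m.
Proof.
set A := (_ - _ : 'M_n.+2).
have AE (i j : 'I_n.+2) : A i j = a *+ (i == j :> nat) -
    b * ((i == j.+1 :> nat)%:R + m *+ ((i == 0%N :> nat) && (j == n.+1 :> nat))).
  by rewrite !mxE.
rewrite (expand_det_row A ord0) big_ord_recl big_ord_recr /= big1 => [|j _].
  rewrite !AE /= !(mulr0n, mulr1n, add0r, addr0, mulr0, subr0, lift0, eqxx).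
  congr (_ + _).
    rewrite exprS /cofactor /= expr0 mul1r; congr (_ * _).
    rewrite det_trig => [|]; last first.
      apply/is_trig_mxP => i j lt_ij; rewrite mxE mxE AE /= /bump /= !add1n.
      by rewrite !eqSS (ltn_eqF lt_ij) ltn_eqF ?addr0 ?mulr0 ?subr0 // ltnS ltnW.
    rewrite -[RHS](_ : \prod_(i < n.+1) a = _); last by rewrite prodr_const card_ord.
    apply: eq_bigr => i _; rewrite mxE mxE AE /= /bump /= !add1n eqxx.
    by rewrite ltn_eqF // addr0 mulr0 subr0.
  rewrite /cofactor /= -det_tr det_trig => [|]; last first.
    apply/is_trig_mxP => i j lt_ij.
    rewrite mxE mxE mxE AE /= /bump /= !add1n [(n < i)%N]ltnNge -ltnS ltn_ord.
    rewrite add0n eqSS !gtn_eqF ?addr0 ?mulr0 ?subr0 //.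
    by rewrite ltnS ltnW.
  under eq_bigr => i _.
    rewrite mxE mxE mxE AE /= /bump /= !add1n [(n < i)%N]ltnNge -ltnS ltn_ord.
    rewrite add0n eqxx gtn_eqF // addr0 mulr1 sub0r.
    over.
  rewrite prodr_const card_ord /bump leq0n add0n add1n -exprMn.
  by rewrite mulrNN mul1r mulNr mulrAC -exprS.
rewrite AE /= /bump /= add1n !eqSS (ltn_eqF (ltn_ord j)) /=.
by rewrite !mulr0n addr0 mulr0 subr0 mul0r.
Qed.

(** The norm of a^3 - x^3 = (a - x) (a - w x) (a - w^2 x), where w is a cube root
    of unity: each factor has norm a^N - m, as 3 divides N. *)
Lemma det_sub_root_mx_cube {F : comNzRingType} {n : nat} (m a w : F) :
  1 + w + w ^+ 2 = 0 -> (3 %| n.+2)%N ->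
  \det ((a ^+ 3)%:M - root_mx m ^+ 3 : 'M_n.+2) = (a ^+ n.+2 - m) ^+ 3.
Proof.
move=> w_root /dvdnP[q def_N].
have w3 : w ^+ 3 = 1.
  have factor3 : w ^+ 3 - 1 = (w - 1) * (1 + w + w ^+ 2) by ring.
  by rewrite -[LHS](subrK 1) factor3 w_root mulr0 add0r.
have wN : w ^+ n.+2 = 1 by rewrite def_N mulnC exprM w3 expr1n.
set C := root_mx m.
have -> : (a ^+ 3)%:M - C ^+ 3 =
    (a%:M - 1 *: C) * (a%:M - w *: C) * (a%:M - w ^+ 2 *: C) :> 'M_n.+2.
  have hP b : a%:M - b *: C = horner_mx C (a%:P - b%:P * 'X).
    by rewrite rmorphB rmorphM /= !horner_mx_C horner_mx_X -[_ * C]/(_ *m C) mul_scalar_mx.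
  have -> : (a ^+ 3)%:M - C ^+ 3 = horner_mx C (a%:P ^+ 3 - 'X ^+ 3).
    by rewrite -polyC_exp rmorphB /= horner_mx_C (rmorphXn (horner_mx C)) /= horner_mx_X.
  rewrite !hP -!rmorphM /=; congr (horner_mx C _).
  have wP : 1 + w%:P + w%:P ^+ 2 = 0 :> {poly F}.
    by rewrite -[RHS](congr1 polyC w_root) !rmorphD /= rmorphXn.
  rewrite polyC_exp polyC1; apply/eqP; rewrite -subr_eq0; apply/eqP.
  (* The difference of both sides is a multiple of 1 + w + w^2; this is the
     cofactor. *)
  rewrite -[RHS](mul0r (a%:P ^+ 2 * 'X - w%:P * a%:P * 'X ^+ 2 + (w%:P - 1) * 'X ^+ 3)).
  by rewrite -wP; ring.
rewrite !detM !det_sub_root_mx -exprM mulnC exprM wN !expr1n !mul1r.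
by move: (_ - m) => D; rewrite -[D * D]/(D ^+ 2) -exprSr.
Qed.

(** The formula does not mention w, so it descends to the rationals from a field
    that contains a primitive cube root of unity. *)
Lemma det_sub_root_mx_cube_rat {n : nat} (m a : rat) : (3 %| n.+2)%N ->
  \det ((a ^+ 3)%:M - root_mx m ^+ 3 : 'M_n.+2) = (a ^+ n.+2 - m) ^+ 3.
Proof.
move=> dvd3; have [w w_prim] := C_prim_root_exists (isT : (0 < 3)%N).
have w_root : 1 + w + w ^+ 2 = 0.
  have w_neq1 : w - 1 != 0.
    by rewrite subr_eq0 -[w]expr1 -(prim_order_dvd w_prim).
  apply: (mulfI w_neq1); rewrite mulr0 -[RHS](subrr (1 : algC)).
  by rewrite -[X in _ = X - _](prim_expr_order w_prim); ring.
apply: (fmorph_inj (ratr : {rmorphism rat -> algC})).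
have map_root : map_mx ratr (root_mx m) = root_mx (ratr m) :> 'M[algC]_n.+2.
  by apply/matrixP => i j; rewrite !mxE rmorphD !rmorphMn rmorph1.
rewrite -det_map_mx map_mxB map_scalar_mx !rmorphXn rmorphB !rmorphXn /=.
by rewrite -(det_sub_root_mx_cube (ratr m) (ratr a) w w_root dvd3) map_root rmorphXn.
Qed.

(** The tuple lists the coefficients of (k - x)^3 (k^3 - x^3)^2, whose expansion
    k^9 - 3 k^8 x + ... + 3 k x^8 - x^9 is reduced modulo x^9 = m. *)
Lemma form_norm_mul_cubes (k m : rat) :
  form_norm m (in_tuple [:: k ^+ 9 - m; - 3 * k ^+ 8; 3 * k ^+ 7; - 3 * k ^+ 6;
    6 * k ^+ 5; - 6 * k ^+ 4; 3 * k ^+ 3; - 3 * k ^+ 2; 3 * k]) =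
  (k ^+ 9 - m) ^+ 9.
Proof.
set s := in_tuple _; set C : 'M_9 := root_mx m.
have -> : form_norm m s =
    \det ((k%:M - 1 *: C) ^+ 3 * ((k ^+ 3)%:M - C ^+ 3) ^+ 2).
  rewrite /form_norm form_mx_horner -/C scale1r; congr (\det _).
  have -> : (k ^+ 3)%:M - C ^+ 3 = horner_mx C (k%:P ^+ 3 - 'X ^+ 3).
    by rewrite -polyC_exp rmorphB /= horner_mx_C (rmorphXn (horner_mx C)) /= horner_mx_X.
  have -> : k%:M - C = horner_mx C (k%:P - 'X).
    by rewrite rmorphB /= horner_mx_C horner_mx_X.
  have CN : horner_mx C ('X ^+ 9 - m%:P) = 0.
    by rewrite rmorphB /= rmorphXn /= horner_mx_C horner_mx_X root_mx_exp_size subrr.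
  rewrite -!rmorphXn -rmorphM /= -[LHS]subr0 -CN -rmorphB /=.
  congr (horner_mx C _).
  rewrite poly_def !big_ord_recl big_ord0 /= -!mul_polyC.
  by rewrite /bump /=; ring.
rewrite !exprS !expr0 !mulr1 !detM det_sub_root_mx det_sub_root_mx_cube_rat //.
ring.
Qed.

(** * The two conjugate solutions *)

Theorem mainTheorem7 (k r eps : rat) (hr : r != 0)
    (heps : eps = 1 \/ eps = -1) :
  let t := r * k ^+ 8 in
  let m := k / r * (t - 3 * eps) in
  let s1 : 9.-tuple rat :=
    in_tuple [:: 1; - eps * r * k ^+ 7; eps * r * k ^+ 6; - eps * r * k ^+ 5;
           2 * eps * r * k ^+ 4; - 2 * eps * r * k ^+ 3; eps * r * k ^+ 2;
           - eps * r * k; eps * r] in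
  let s2 : 9.-tuple rat :=
    in_tuple [::
       9 * t ^+ 4 - 54 * eps * t ^+ 3 + 97 * t ^+ 2 - 48 * eps * t + 1;
       r * k ^+ 7 * (9 * t ^+ 3 - 51 * eps * t ^+ 2 + 84 * t - 35 * eps);
       r * k ^+ 6 * (9 * t ^+ 3 - 48 * eps * t ^+ 2 + 72 * t - 25 * eps);
       r * k ^+ 5 * (9 * t ^+ 3 - 45 * eps * t ^+ 2 + 61 * t - 17 * eps);
       r * k ^+ 4 * (9 * t ^+ 3 - 42 * eps * t ^+ 2 + 51 * t - 11 * eps);
       r * k ^+ 3 * (9 * t ^+ 3 - 39 * eps * t ^+ 2 + 42 * t - 7 * eps);
       r * k ^+ 2 * (9 * t ^+ 3 - 36 * eps * t ^+ 2 + 34 * t - 4 * eps);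
       r * k * (9 * t ^+ 3 - 33 * eps * t ^+ 2 + 27 * t - 2 * eps);
       r * (9 * t ^+ 3 - 30 * eps * t ^+ 2 + 21 * t - eps)] in
  [/\ form_norm m s1 = 1, form_norm m s2 = 1,
      form_conjugate m s1 s2 & form_conjugate m s2 s1].
Proof.
move=> t m s1 s2.
have mul12 : form_mx m s1 *m form_mx m s2 = 1%:M.
  apply: form_mx_mul_eq1 => i; rewrite mxE !big_ord_recr big_ord0 /=.
  case: heps => eps1; rewrite {}/s1 {}/s2 {}/m {}/t eps1;
    case: i => [[|[|[|[|[|[|[|[|[|//]]]]]]]]] lt_i];
    by rewrite !mxE /=; field.
have norm1 : form_norm m s1 = 1.
  have [k0|k0] := eqVneq k 0.
    by rewrite /m k0 !mul0r form_norm0 expr1n.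
  have eps0 : eps != 0 by case: heps => ->.
  (* The scalar c for which (k - x)^3 (k^3 - x^3)^2 = c * s1 modulo x^9 = m. *)
  pose c := 3 * eps * k / r.
  have c0 : c != 0 by rewrite !mulf_neq0 ?invr_eq0.
  have cE : k ^+ 9 - m = c by rewrite /m /t /c; field.
  apply: (mulfI (expf_neq0 9 c0)).
  rewrite mulr1 -[in RHS]cE -form_norm_mul_cubes; apply/esym/form_normZ => i.
  case: i => [[|[|[|[|[|[|[|[|[|//]]]]]]]]] lt_i] /=;
    by rewrite ?cE /c; case: heps => ->; field.
(* The norm is multiplicative and the product of the two forms is 1. *)
have norm2 : form_norm m s2 = 1.
  by have := congr1 determinant mul12; rewrite det_mulmx [X in X * _]norm1 mul1r det1.
split=> //; rewrite /form_conjugate ?norm1 ?norm2 //.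
by rewrite form_mx_mulC.
Qed.
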